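(* Let $G$ be a connected ELC-preserved $(r,k-r)$-bipartite graph on $k\ge 2$ vertices with $r\le k-r$, and let $m>1$ be an integer. Let $G$ correspond to a $[k,r,d]$ code and its dual $[k,k-r,d']$ code. Then $S_+^m(G)$ corresponds to an $[mk,\,r,\,md]$ code and its dual $[mk,\,mk-r,\,2]$ code, and $S_-^m(G)$ corresponds to an $[mk,\,k-r,\,md']$ code and its dual $[mk,\,mk-k+r,\,2]$ code.
   Context: All graphs are finite, simple and undirected. For a graph $G=(V,E)$ and $v\in V$, $N_v$ is the set of vertices adjacent to $v$. Local complementation (LC) on $v$ transforms $G$ into $G*v$ by replacing the induced subgraph of $G$ on $N_v$ by its complement. For an edge $\{u,v\}\in E$, edge local complementation (ELC) on $\{u,v\}$ transforms $G$ into $G^{(u,v)}=G*u*v*u=G*v*u*v$ (operations applied from left to right). $G$ is ELC-preserved if for every edge $\{u,v\}\in E$, $G^{(u,v)}$ is isomorphic to $G$. An $(a,b)$-bipartite graph is a bipartite graph whose two partitions (independent sets decomposing the vertex set) have sizes $a$ and $b$. An $[n,k,d]$ code is a $k$-dimensional subspace of $\mathbb{F}_2^n$ with minimum distance $d$; two codes are equivalent if one is obtained from the other by a permutation of coordinates. A bipartite graph corresponds to an $[n,k]$ code $\mathcal{C}$ if it is isomorphic to the $(k,n-k)$-bipartite graph with adjacency matrix $\begin{pmatrix}\mathbf{0}_{k\times k}&P\\P^{\mathrm T}&\mathbf{0}_{(n-k)\times(n-k)}\end{pmatrix}$ for some generator matrix $(I\mid P)$ of a code equivalent to $\mathcal{C}$.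 (Up to isomorphism, the same graph then also corresponds to the dual code $\mathcal{C}^\perp$, generated up to equivalence by $(P^{\mathrm T}\mid I)$.) Here the $[k,r,d]$ code is the one generated, up to equivalence, by $(I\mid P)$ with $P$ having rows indexed by the partition $U$ of size $r$ and columns indexed by the partition $W$ of size $k-r$, where $P_{u,w}=1$ if and only if $u$ and $w$ are adjacent in $G$. Star expansion: $e^m$ is the graph on $m$ vertices with no edges. Substituting a vertex $v$ of $G=(V,E)$ with $e^m$ means replacing $v$ by $m$ pairwise non-adjacent new vertices, each joined to exactly the neighbors of $v$. Adding a pendant at $v$ means adding a new vertex whose only neighbor is $v$. $S_+^m(G)$ is obtained from $G$ by substituting all vertices of the larger partition (the partition $W$ of size $k-r$) with $e^m$ and adding $m-1$ pendants to each vertex of the other partition $U$; $S_-^m(G)$ is obtained by substituting all vertices of the smaller partition (the partition $U$ of size $r$) with $e^m$ and adding $m-1$ pendants to each vertex of $W$. *)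

(* Defs.v *)
From mathcomp Require Import all_boot all_order all_fingroup all_algebra.

Set Implicit Arguments.
Unset Strict Implicit.
Unset Printing Implicit Defensive.

Import GRing.Theory.

(** * Finite simple graphs *)

Record graph := Graph {
  vertex :> finType;
  adj : rel vertex;
  adj_sym : symmetric adj;
  adj_irr : irreflexive adj
}.

Definition isomorphic (G H : graph) : Prop :=
  exists2 f : G -> H, bijective f & forall x y, adj (f x) (f y) = adj x y.

Definition connected (G : graph) : Prop := forall x y : G, connect (@adj G) x y.

Definition independent (G : graph) (A : {set G}) : Prop :=
  {in A &, forall x y, ~~ adj x y}.

Definition bipartition (G : graph) (U W : {set G}) : Prop :=
  [/\ U :|: W = setT, [disjoint U & W], independent U & independent W].

(** ** Local and edge local complementation *)

Section LocalComplementation.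
Variables (G : graph) (v : G).

Definition lc_adj : rel G := fun x y =>
  if [&& x != y, adj v x & adj v y] then ~~ adj x y else adj x y.

Lemma lc_sym : symmetric lc_adj.
Proof.
by move=> x y; rewrite /lc_adj eq_sym (adj_sym x y) [adj v x && _]andbC.
Qed.

Lemma lc_irr : irreflexive lc_adj.
Proof. by move=> x; rewrite /lc_adj eqxx /= adj_irr. Qed.

Definition lc : graph := Graph lc_sym lc_irr.

End LocalComplementation.

Definition elc (G : graph) (u v : G) : graph :=
  let G1 := lc u in let G2 := lc (v : G1) in lc (u : G2).

Definition elc_preserved (G : graph) : Prop :=
  forall u v : G, adj u v -> isomorphic (elc u v) G.

(** ** Star expansion *)

Section Substitution.
Variables (G : graph) (A : {set G}) (m : nat).

(** A vertex outside [A] keeps exactly one copy. *)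
Definition copies (x : G) : nat := if x \in A then m else 1.

Definition subst_adj : rel {x : G & 'I_(copies x)} :=
  fun a b => adj (tag a) (tag b).

Lemma subst_sym : symmetric subst_adj.
Proof. by move=> a b; exact: adj_sym. Qed.

Lemma subst_irr : irreflexive subst_adj.
Proof. by move=> a; exact: adj_irr. Qed.

Definition substitute : graph := Graph subst_sym subst_irr.

End Substitution.

Section Pendants.
Variables (G : graph) (B : {set G}) (p : nat).

Definition pendant_adj : rel (G + {b : G | b \in B} * 'I_p) := fun a b =>
  match a, b with
  | inl x, inl y => adj x y
  | inl x, inr q => x == val q.1
  | inr q, inl y => y == val q.1
  | inr _, inr _ => false
  end.

Lemma pendant_sym : symmetric pendant_adj.
Proof. by move=> [x|q] [y|q'] //=; exact: adj_sym. Qed.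

Lemma pendant_irr : irreflexive pendant_adj.
Proof. by move=> [x|q] //=; exact: adj_irr. Qed.

Definition add_pendants : graph := Graph pendant_sym pendant_irr.

End Pendants.

(** Substitute every vertex of [A] with [e^m], and add [m - 1] pendants to
    every vertex of [B] (for [A] and [B] disjoint). *)
Definition star_expansion (G : graph) (A B : {set G}) (m : nat) : graph :=
  add_pendants [set a : substitute A m | tag a \in B] m.-1.

(** [U] is the smaller and [W] the larger part of the bipartition. *)
Definition S_plus (G : graph) (U W : {set G}) (m : nat) : graph :=
  star_expansion W U m.

Definition S_minus (G : graph) (U W : {set G}) (m : nat) : graph :=
  star_expansion U W m.

(** * Binary linear codes *)

Notation code n := {vspace 'rV['F_2]_n}.

Definition hamming (n : nat) (x y : 'rV['F_2]_n) : nat :=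
  #|[set i | x ord0 i != y ord0 i]|.

(** The zero code has no minimum distance. *)
Definition min_distance (n : nat) (C : code n) (d : nat) : Prop :=
  (exists x y, [/\ x \in C, y \in C, x != y & hamming x y = d]) /\
  (forall x y, x \in C -> y \in C -> x != y -> d <= hamming x y).

Definition is_code (n k d : nat) (C : code n) : Prop :=
  \dim C = k /\ min_distance C d.

Definition dual (n : nat) (C : code n) : code n :=
  (\bigcap_(y | y \in C) lker (linfun (mulmxr (y^T)%R : 'rV_n -> 'M_1)))%VS.

Lemma mem_dual (n : nat) (C : code n) (x : 'rV['F_2]_n) :
  reflect (forall y, y \in C -> (x *m y^T = 0)%R) (x \in dual C).
Proof.
rewrite memvE; apply: (iffP subv_bigcapP) => xP y yC; have := xP y yC;
  rewrite -memvE memv_ker lfunE /=.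
  by move/eqP.
by move=> ->.
Qed.

Definition code_equiv (n : nat) (C D : code n) : Prop :=
  exists s : 'S_n, D = (linfun (col_perm s : 'rV['F_2]_n -> 'rV_n) @: C)%VS.

Definition row_code (k n : nat) (M : 'M['F_2]_(k, n)) : code n :=
  <<[seq row i M | i : 'I_k]>>%VS.

(** [C] is equivalent to the code generated by [(I | P)]. *)
Definition std_generated (n k l : nat) (C : code n) (P : 'M['F_2]_(k, l)) :
    Prop :=
  exists eq_n : k + l = n,
    code_equiv C (row_code (castmx (erefl k, eq_n) (row_mx 1%:M%R P))).

(** * Graphs and codes *)

Section BipartiteGraph.
Variables (k l : nat) (P : 'M['F_2]_(k, l)).

Definition bip_mx : 'M['F_2]_(k + l) := (block_mx 0 P P^T 0)%R.

Definition bip_adj : rel 'I_(k + l) := fun i j => (bip_mx i j == 1)%R.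

Lemma bip_sym : symmetric bip_adj.
Proof.
have bipT : (bip_mx^T = bip_mx)%R by rewrite tr_block_mx !trmx0 trmxK.
by move=> i j; rewrite /bip_adj -[in LHS]bipT mxE.
Qed.

Lemma bip_irr : irreflexive bip_adj.
Proof.
by move=> i; rewrite /bip_adj /bip_mx; case: (split_ordP i) => j ->;
  rewrite ?block_mxEul ?block_mxEdr mxE.
Qed.

Definition bip_graph : graph := Graph bip_sym bip_irr.

End BipartiteGraph.

Definition corresponds (G : graph) (n : nat) (C : code n) : Prop :=
  exists (k l : nat) (P : 'M['F_2]_(k, l)),
    std_generated C P /\ isomorphic G (bip_graph P).

(** Rows indexed by [U], columns by [W]; the choice of orderings affects the
    code generated by [(I | P)] only up to equivalence. *)
Definition biadjacency (G : graph) (U W : {set G}) : 'M['F_2]_(#|U|, #|W|) :=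
  \matrix_(i, j) ((adj (enum_val i) (enum_val j))%:R)%R.

(* Main.v *)
Require Import Defs.
From mathcomp Require Import all_boot all_order all_fingroup all_algebra.
From Stdlib Require Import Setoid.

Set Implicit Arguments.
Unset Strict Implicit.
Unset Printing Implicit Defensive.

Import GRing.Theory.

(** The star expansion of a bipartite graph is the graph form of the [m]-fold
    repetition of its code.  Let [G] have parts [A] and [B], and let [(I | P)]
    be the generator matrix with rows indexed by [A] and columns by [B].  Each
    vertex of [G] is then a coordinate, and the codeword with message
    [X \subset A] is supported on the vertices of [X] together with the
    vertices of [B] having an odd number of neighbours in [X]; this set of
    vertices is [codeword X].

    In [star_expansion B A m] keep one copy of every vertex of [A] as the
    message part.  A copy of [w] in [B] sees the same neighbours as [w], and a
    pendant at [u] in [A] sees [u] alone, so the corresponding coordinates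
    repeat those of [w] and [u].  Hence [codeword] in the expansion is the
    preimage of [codeword] in [G] under the projection [star_proj]
    ([codeword_star]).  Every fibre of this projection has [m] elements, being
    either [m] copies of [w], or [u] and its [m - 1] pendants
    ([card_star_proj]).  So all weights are multiplied by [m], the length
    becomes [m * #|G|] and the dimension remains [#|A|].

    The dual code is generated by [(I | P^T)] up to equivalence
    ([std_generated_dual]), which is the same construction with the two parts
    exchanged.  Its minimum distance is 2 ([min_codeword_star_dual]): a pendant
    and its centre form a codeword, and since no vertex is isolated (the
    graph is connected on at least two vertices) there is no codeword of
    weight 1.

    These facts for [A = U], [B = W] and the given code yield the first half of
    the theorem; the second half is the case [A = W], [B = U] of its dual. *)

(** * Codes generated by a matrix, equivalence and duality *)

Lemma row_code_limg k n (M : 'M['F_2]_(k, n)) :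
  row_code M = limg (linfun (mulmxr M : 'rV_k -> 'rV_n)).
Proof.
apply/esym/eqP; rewrite eqEsubv; apply/andP; split; apply/subvP => z.
  case/memv_imgP => y _ ->; rewrite lfunE /= mulmx_sum_row.
  apply: rpred_sum => i _; apply/rpredZ/memv_span.
  by apply/mapP; exists i => //; rewrite mem_enum.
apply/subvP/span_subvP => _ /mapP[i _ ->].
apply/memv_imgP; exists (delta_mx 0 i)%R; first exact: memvf.
by rewrite lfunE /= rowE.
Qed.

Lemma row_codeP k n (M : 'M['F_2]_(k, n)) (x : 'rV_n) :
  reflect (exists y : 'rV_k, x = y *m M)%R (x \in row_code M).
Proof.
rewrite row_code_limg; apply: (iffP memv_imgP) => [[y _ ->]|[y ->]]; exists y.
- by rewrite lfunE.
- exact: memvf.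
- by rewrite lfunE.
Qed.

Lemma dim_row_code k n (M : 'M['F_2]_(k, n)) :
  (forall y : 'rV_k, y *m M = 0 -> y = 0)%R -> \dim (row_code M) = k.
Proof.
move=> injM; rewrite row_code_limg limg_dim_eq ?dimvf /dim /= ?mul1n //.
apply/eqP; rewrite -subv0; apply/subvP => y; rewrite memv_cap memvf /=.
by rewrite memv_ker lfunE memv0 /= => /eqP/injM ->.
Qed.

Lemma col_perm_code_inj n (s : 'S_n) :
  injective (linfun (col_perm s : 'rV['F_2]_n -> 'rV_n)).
Proof.
move=> x y; rewrite !lfunE /= => /(congr1 (col_perm s^-1)).
by rewrite -!col_permM mulVg !col_perm1.
Qed.

Lemma mem_code_equiv n (s : 'S_n) (C : code n) (x : 'rV_n) :
  (x \in (linfun (col_perm s : 'rV['F_2]_n -> 'rV_n) @: C)%VS)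
    = (col_perm s^-1 x \in C).
Proof.
have {1}-> : x = linfun (col_perm s : 'rV['F_2]_n -> 'rV_n) (col_perm s^-1 x).
  by rewrite lfunE /= -col_permM mulgV col_perm1.
apply/memv_imgP/idP => [[y yC /col_perm_code_inj ->]//|xC].
by exists (col_perm s^-1 x).
Qed.

Lemma code_equiv_trans n (C D E : code n) :
  code_equiv C D -> code_equiv D E -> code_equiv C E.
Proof.
move=> [s ->] [t ->]; exists (t * s)%g; apply/vspaceP => x.
by rewrite !mem_code_equiv invMg col_permM.
Qed.

Lemma code_equiv_dim n (C D : code n) : code_equiv C D -> \dim C = \dim D.
Proof.
case=> s ->; rewrite limg_dim_eq //; apply/eqP; rewrite -subv0.
apply/subvP => x; rewrite memv_cap memv_ker memv0 => /andP[_ /eqP x0].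
by apply/eqP/(@col_perm_code_inj _ s); rewrite x0 linear0.
Qed.

(** Permuting coordinates preserves the standard inner product. *)
Lemma code_equiv_dual n (C D : code n) :
  code_equiv C D -> code_equiv (dual C) (dual D).
Proof.
case=> s ->; exists s; apply/vspaceP => x; rewrite mem_code_equiv.
have dot (y z : 'rV['F_2]_n) :
    (col_perm s^-1 y *m z^T = y *m (col_perm s z)^T)%R.
  apply/matrixP => i j; rewrite !mxE (reindex_perm s) /=.
  by apply: eq_bigr => h _; rewrite !mxE permK.
apply/mem_dual/mem_dual => xC y.
  move=> yC; rewrite dot; apply: xC.
  by rewrite mem_code_equiv -col_permM mulVg col_perm1.
rewrite mem_code_equiv => /xC; rewrite dot.
by rewrite -col_permM mulgV col_perm1.
Qed.

Definition weight n (x : 'rV['F_2]_n) := #|[set i | x ord0 i != 0%R]|.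

Lemma hammingE n (x y : 'rV['F_2]_n) : hamming x y = weight (x - y)%R.
Proof.
by apply/eq_card => i; rewrite !inE !mxE subr_eq0.
Qed.

(** By linearity a difference of codewords is a codeword. *)
Lemma min_distanceE n (C : code n) d :
  min_distance C d <->
  (exists x, [/\ x \in C, x != 0%R & weight x = d]) /\
  (forall x, x \in C -> x != 0%R -> d <= weight x).
Proof.
split=> -[[x]].
  move=> [y [xC yC xy <-]] dmin; split.
    by exists (x - y)%R; rewrite rpredB // subr_eq0 hammingE.
  by move=> z zC z0;
    have := dmin z 0%R zC (mem0v C) z0; rewrite (hammingE z) subr0.
move=> [xC x0 <-] dmin; split.
  by exists x, 0%R; rewrite mem0v hammingE subr0.
move=> y z yC zC yz; rewrite hammingE.
by apply: dmin; rewrite ?rpredB // subr_eq0.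
Qed.

Lemma weight_col_perm n (s : 'S_n) (x : 'rV['F_2]_n) :
  weight (col_perm s x) = weight x.
Proof.
rewrite /weight -[RHS](card_imset _ (@perm_inj _ s^-1)).
apply/eq_card => i; rewrite !inE mxE.
apply/idP/imsetP => [xi|[j]]; last by rewrite inE => ? ->; rewrite permKV.
by exists (s i); rewrite ?inE // permK.
Qed.

Lemma code_equiv_min_distance n (C D : code n) d :
  code_equiv C D -> min_distance C d <-> min_distance D d.
Proof.
case=> s ->; rewrite !min_distanceE.
have nz t (x : 'rV['F_2]_n) : (col_perm t x != 0 = (x != 0))%R.
  congr (~~ _); apply/eqP/eqP => [/(congr1 (col_perm t^-1))|->].
    by rewrite -col_permM mulVg col_perm1 linear0.
  by rewrite linear0.
split=> -[[x [xC x0 <-]] dmin]; split.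
- exists (col_perm s x); rewrite mem_code_equiv -col_permM mulVg col_perm1.
  by rewrite nz weight_col_perm.
- move=> y; rewrite mem_code_equiv => yC y0.
  by have := dmin _ yC; rewrite nz weight_col_perm; apply.
- exists (col_perm s^-1 x); rewrite nz weight_col_perm.
  by rewrite -mem_code_equiv.
move=> y yC y0; rewrite -(weight_col_perm s y); apply: dmin; last by rewrite nz.
by rewrite mem_code_equiv -col_permM mulVg col_perm1.
Qed.

Lemma std_generated_exists n k l (P : 'M['F_2]_(k, l)) :
  k + l = n -> exists C : code n, std_generated C P.
Proof.
move=> eq_n; exists (row_code (castmx (erefl k, eq_n) (row_mx 1%:M%R P))).
exists eq_n, 1%g; apply/vspaceP => x.
by rewrite mem_code_equiv invg1 col_perm1.
Qed.

Lemma std_generated_dim n k l (C : code n) (P : 'M['F_2]_(k, l)) :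
  std_generated C P -> \dim C = k.
Proof.
case=> eq_n; case: n / eq_n C => C /code_equiv_dim ->; rewrite castmx_id.
apply: dim_row_code => y; rewrite mul_mx_row mulmx1 => /eqP.
by rewrite row_mx_eq0 => /andP[/eqP].
Qed.

Lemma std_generated_equiv n k l (C D : code n) (P : 'M['F_2]_(k, l)) :
  code_equiv C D -> std_generated D P -> std_generated C P.
Proof. by move=> CD [e DP]; exists e; apply: code_equiv_trans DP. Qed.

(** Orthogonality to the [i]-th row [(e_i | P_i)] says that [x_i] is the sum of
    the [P_ij y_j], up to a sign that disappears in characteristic 2. *)
Lemma dual_row_code k l (P : 'M['F_2]_(k, l)) (x : 'rV_k) (y : 'rV_l) :
  (row_mx x y \in dual (row_code (row_mx 1%:M P))) = (x == y *m P^T)%R.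
Proof.
have N2 (a b : 'rV['F_2]_k) : (a + b == 0 = (a == b))%R.
  rewrite addr_eq0; congr (_ == _); apply/matrixP => i j; rewrite mxE.
  by case: (b i j) => -[|[|]] // ?; apply/val_inj.
rewrite -N2; apply/mem_dual/eqP => [xy|xy _ /row_codeP[z ->]].
  apply/trmx_inj/row_matrixP => i; rewrite trmx0 row0.
  have /xy/(congr1 trmx) :
      (row i (row_mx 1%:M P) \in row_code (row_mx 1%:M P))%R.
    by apply/row_codeP; exists (delta_mx 0 i)%R; rewrite rowE.
  rewrite trmx_mul trmxK trmx0 -row_mul => <-; congr row.
  rewrite tr_row_mx mul_row_col mul1mx.
  by rewrite linearD /= trmx_mul trmxK.
by rewrite trmx_mul mulmxA tr_row_mx mul_row_col trmx1 mulmx1 xy mul0mx.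
Qed.

(** The words of the dual are the [(y P^T | y)], so exchanging the two blocks of
    coordinates gives the words [(y | y P^T)] generated by [(I | P^T)]. *)
Lemma std_generated_dual n k l (C : code n) (P : 'M['F_2]_(k, l)) :
  std_generated C P -> std_generated (dual C) P^T%R.
Proof.
case=> eq_n; case: n / eq_n C => C /code_equiv_dual; rewrite castmx_id.
move/std_generated_equiv; apply; exists (addnC l k).
pose swap (i : 'I_(k + l)) : 'I_(k + l) :=
  match split (cast_ord (esym (addnC l k)) i) with
  | inl j => rshift k j
  | inr j => lshift l j
  end.
have swap_inj : injective swap.
  move=> i j; rewrite /swap.
  set i' := cast_ord _ i; set j' := cast_ord _ j => E.
  apply: (@cast_ord_inj _ _ (esym (addnC l k))); rewrite -/i' -/j'.
  move: E; case: (split_ordP i') => a ->; case: (split_ordP j') => b ->;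
    rewrite ?(unsplitK (inl _)) ?(unsplitK (inr _)) //.
  - by move/rshift_inj ->.
  - by move/eqP; rewrite eq_rlshift.
  - by move/eqP; rewrite eq_lrshift.
  - by move/lshift_inj ->.
have col_swap (x : 'rV['F_2]_k) (y : 'rV_l) :
    col_perm (perm swap_inj) (row_mx x y) =
    castmx (erefl 1, addnC l k) (row_mx y x).
  apply/matrixP => i j; rewrite castmxE cast_ord_id mxE permE /swap.
  by case: (split_ordP (cast_ord _ j)) => a ->; rewrite ?row_mxEl ?row_mxEr.
exists (perm swap_inj); apply/vspaceP => z.
rewrite mem_code_equiv.
have [x [y ->]] : exists x y, z = castmx (erefl 1, addnC l k) (row_mx y x).
  pose z' := castmx (erefl 1, esym (addnC l k)) z.
  by exists (rsubmx z'), (lsubmx z'); rewrite hsubmxK castmx_comp castmx_id.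
rewrite -col_swap -col_permM mulVg col_perm1 dual_row_code col_swap.
have mulc (u : 'rV['F_2]_l) :
    (u *m castmx (erefl l, addnC l k) (row_mx 1%:M P^T) =
     castmx (erefl 1%N, addnC l k) (row_mx u (u *m P^T)))%R.
  by case: _ / (addnC l k); rewrite !castmx_id mul_mx_row mulmx1.
apply/row_codeP/eqP => [[u]|->]; last by exists y; rewrite mulc.
rewrite mulc => /(congr1 (castmx (erefl, esym (addnC l k)))).
by rewrite !castmx_comp !castmx_id => /eq_row_mx[-> ->].
Qed.

(** * Codewords as vertex sets of a bipartite graph *)

Section GraphCodes.
Variable G : graph.
Implicit Types A B X : {set G}.

(** For [X] inside one part of a bipartition, this is the support of the word
    that [(I | P)] assigns to the indicator of [X].  The exclusive or lets one
    formula cover both parts, since one of its two terms vanishes on each. *)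
Definition codeword X : {set G} :=
  [set z | (z \in X) (+) odd #|[set x in X | adj z x]|].

Lemma codeword_independent A X z : independent A -> X \subset A -> z \in A ->
  (z \in codeword X) = (z \in X).
Proof.
move=> iA XA zA; rewrite inE eq_card0 ?addbF // => x; rewrite !inE.
case xX: (x \in X) => //=; apply/negbTE/iA => //; exact: subsetP xX.
Qed.

Lemma codeword1 y : codeword [set y] = [set z | (z == y) || adj z y].
Proof.
apply/setP => z; rewrite !inE; have [->|zy] := eqVneq z y.
  rewrite eq_card0 // => x; rewrite !inE.
  by case: eqP => //= ->; rewrite adj_irr.
rewrite addFb; case zy1: (adj z y).
  rewrite (eq_card (B := pred1 y)) ?card1 // => x.
  by rewrite !inE; case: eqP => // ->.
by rewrite eq_card0 // => x; rewrite !inE; case: eqP => // ->.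
Qed.

Lemma biadjacency_tr A B : ((biadjacency A B)^T = biadjacency B A)%R.
Proof. by apply/matrixP => i j; rewrite !mxE adj_sym. Qed.

Lemma bipartition_sym A B : bipartition A B -> bipartition B A.
Proof. by case=> AB dAB iA iB; split; rewrite 1?setUC 1?disjoint_sym. Qed.

Lemma bipartition_notin A B x : bipartition A B -> (x \in B) = (x \notin A).
Proof.
case=> AB dAB _ _; have := in_setT x; rewrite -AB inE.
case xA : (x \in A) => //= _; exact: disjointFr dAB xA.
Qed.

Lemma card_bipartition A B : bipartition A B -> #|A| + #|B| = #|G|.
Proof.
move=> AB; rewrite -(cardsC A); congr (_ + _); apply/eq_card => x.
by rewrite inE (bipartition_notin x AB).
Qed.

(** The inverse of the isomorphism from [G] to the graph of its biadjacency
    matrix; it also identifies the coordinates of the code with vertices. *)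
Definition bip_vertex A B (i : 'I_(#|A| + #|B|)) : G :=
  match split i with inl i => enum_val i | inr j => enum_val j end.

Lemma bip_vertexl A B i : bip_vertex (lshift #|B| i) = enum_val (A := A) i.
Proof. by rewrite /bip_vertex (unsplitK (inl _)). Qed.

Lemma bip_vertexr A B j : bip_vertex (rshift #|A| j) = enum_val (A := B) j.
Proof. by rewrite /bip_vertex (unsplitK (inr _)). Qed.

Lemma bip_vertex_bij A B : bipartition A B -> bijective (@bip_vertex A B).
Proof.
move=> AB.
have neAB (i : 'I_#|A|) (j : 'I_#|B|) : enum_val i <> enum_val j.
  move=> E; have := enum_valP j.
  by rewrite (bipartition_notin _ AB) -E enum_valP.
apply: inj_card_bij; last by rewrite card_ord card_bipartition.
move=> i j; case: (split_ordP i) => a ->; case: (split_ordP j) => b ->;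
  rewrite ?bip_vertexl ?bip_vertexr.
- by move/enum_val_inj ->.
- by move/neAB.
- by move/esym/neAB.
- by move/enum_val_inj ->.
Qed.

Lemma bipartite_isomorphic A B :
  bipartition A B -> isomorphic G (bip_graph (biadjacency A B)).
Proof.
move=> AB; have [_ _ iA iB] := AB.
have g_adj i j :
    adj (bip_vertex i) (bip_vertex j) = bip_adj (biadjacency A B) i j.
  rewrite /bip_adj /bip_mx.
  case: (split_ordP i) => a ->; case: (split_ordP j) => b ->;
    rewrite ?bip_vertexl ?bip_vertexr;
    rewrite ?block_mxEul ?block_mxEur ?block_mxEdl ?block_mxEdr !mxE.
  - by apply/negbTE/iA; exact: enum_valP.
  - by case: adj.
  - by rewrite adj_sym; case: adj.
  - by apply/negbTE/iB; exact: enum_valP.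
have [f fK gK] := bip_vertex_bij AB.
exists f; first by exists (@bip_vertex A B).
by move=> x y; rewrite -[in RHS](gK x) -[in RHS](gK y) g_adj.
Qed.

Lemma std_generated_corresponds n (C : code n) A B :
  bipartition A B -> std_generated C (biadjacency A B) -> corresponds G C.
Proof.
move=> AB CP; exists #|A|, #|B|, (biadjacency A B); split=> //.
exact: bipartite_isomorphic.
Qed.

(** The minimum distance of the code with message part [A], as a statement about
    vertex sets only. *)
Definition min_codeword A d :=
  (exists X, [/\ X \subset A, X != set0 & #|codeword X| = d]) /\
  (forall X, X \subset A -> X != set0 -> d <= #|codeword X|).

Definition message A X : 'rV['F_2]_#|A| := (\row_i (enum_val i \in X)%:R)%R.

Lemma messageP A (x : 'rV_#|A|) :
  exists2 X : {set G}, X \subset A & x = message A X.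
Proof.
exists [set enum_val i | i in [pred i | x ord0 i != 0%R]].
  by apply/subsetP => _ /imsetP[i _ ->]; exact: enum_valP.
apply/rowP => i; rewrite mxE mem_imset ?inE; last exact: enum_val_inj.
by case: (x ord0 i) => -[|[|]] // ?; apply/val_inj.
Qed.

Lemma message_eq0 A X : X \subset A -> (message A X == 0)%R = (X == set0).
Proof.
move=> XA; apply/eqP/eqP => [x0|->]; last by apply/rowP => i; rewrite !mxE inE.
apply/setP => z; rewrite inE; apply/negbTE/negP => zX.
have zA := subsetP XA z zX.
have := congr1 (fun x : 'rV['F_2]_#|A| => x ord0 (enum_rank_in zA z)) x0.
by rewrite !mxE enum_rankK_in // zX => /eqP; rewrite oner_eq0.
Qed.

Lemma F2_natr_neq0 n : (n%:R != 0 :> 'F_2)%R = odd n.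
Proof.
by rewrite -(Zp_nat_mod (p := 2)) // modn2; case: odd.
Qed.

(** Over ['F_2] the coordinate of [x P] at [w] counts the neighbours of [w] in
    [X] modulo 2. *)
Lemma weight_message A B X : bipartition A B -> X \subset A ->
  weight (message A X *m row_mx 1%:M (biadjacency A B))%R = #|codeword X|.
Proof.
move=> AB XA; have [_ _ iA _] := AB; rewrite mul_mx_row mulmx1.
rewrite -[RHS](on_card_preimset (onW_bij _ (bip_vertex_bij AB))).
apply/eq_card => i; rewrite [LHS]inE [RHS]inE.
case: (split_ordP i) => j ->;
  rewrite ?row_mxEl ?row_mxEr ?bip_vertexl ?bip_vertexr.
  by rewrite mxE F2_natr_neq0 oddb (codeword_independent iA XA) ?enum_valP.
rewrite inE; have -> : enum_val j \in X = false.
  apply/negbTE/(contra (subsetP XA _)).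
  by rewrite -(bipartition_notin _ AB) enum_valP.
rewrite mxE -F2_natr_neq0; congr (_ != _)%R.
rewrite -[in RHS]sum1_card natr_sum.
pose f z : 'F_2 := ((z \in X) && adj (enum_val j) z)%:R%R.
rewrite (eq_bigr (fun h => f (enum_val h))).
  rewrite -(big_enum_val f) /f /=.
  rewrite big_mkcond [RHS]big_mkcond; apply: eq_bigr => z _ /=.
  rewrite inE; case zX: (z \in X) => /=; last by case: ifP.
  by rewrite (subsetP XA) //; case: adj.
by move=> h _; rewrite /f !mxE -natrM mulnb adj_sym.
Qed.

Lemma std_generated_min_distance n (C : code n) A B d :
  bipartition A B -> std_generated C (biadjacency A B) ->
  min_distance C d <-> min_codeword A d.
Proof.
move=> AB [eq_n]; case: n / eq_n C => C /code_equiv_min_distance ->.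
rewrite castmx_id min_distanceE; set M := row_mx _ _.
have M0 X : X \subset A -> (message A X *m M == 0)%R = (X == set0).
  move=> XA; rewrite -(message_eq0 XA) mul_mx_row mulmx1 row_mx_eq0.
  by case: eqP => //= ->; rewrite mul0mx eqxx.
split=> -[[X]].
  case=> /row_codeP[y ->]; have [Y YA ->] := messageP y.
  rewrite M0 // weight_message // => Y0 wY dmin; split; first by exists Y.
  move=> Z ZA Z0; rewrite -(weight_message AB ZA); apply: dmin.
    by apply/row_codeP; exists (message A Z).
  by rewrite M0.
case=> XA X0 wX dmin; split.
  exists (message A X *m M)%R; rewrite M0 // weight_message //; split=> //.
  by apply/row_codeP; exists (message A X).
move=> _ /row_codeP[y ->]; have [Y YA ->] := messageP y.
by rewrite M0 // weight_message //; exact: dmin.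
Qed.

End GraphCodes.

(** * The star expansion repeats every coordinate *)

Section StarExpansion.
Variables (G : graph) (A B : {set G}) (m : nat).
Hypotheses (AB : bipartition A B) (m_gt0 : 0 < m).
Local Notation star := (star_expansion B A m).

Definition star_proj (z : star) : G :=
  match z with inl a => tag a | inr q => tag (val q.1) end.

Lemma copies_gt0 x : 0 < copies B m x.
Proof. by rewrite /copies; case: ifP. Qed.

(** Picks the copy of index 0, which on [A] is the only one. *)
Definition star_embed (x : G) : star :=
  inl (Tagged (fun x => 'I_(copies B m x)) (Ordinal (copies_gt0 x))).

Lemma star_embedK : cancel star_embed star_proj. Proof. by []. Qed.

Lemma star_embed_inj : injective star_embed.
Proof. exact: can_inj star_embedK. Qed.

Lemma star_embed_proj (a : substitute B m) :
  tag a \in A -> inl a = star_embed (tag a).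
Proof.
case: a => x i /= xA; congr (inl _); congr (existT _ x _).
apply/val_inj => /=; case: i => i /=.
rewrite /copies (bipartition_notin _ AB) xA /=.
by rewrite ltnS leqn0 => /eqP.
Qed.

(** A fibre over [w] in [B] has [m] copies; a fibre over [u] in [A] has one copy
    and [m - 1] pendants. *)
Lemma card_star_proj (T : {set G}) : #|star_proj @^-1: T| = m * #|T|.
Proof.
have card_sum (U : finType) (X : {set U}) : #|X| = \sum_x (x \in X).
  by rewrite -sum1_card big_mkcond; apply: eq_bigr => x _; case: (_ \in _).
have sub_sum (F : G -> nat) :
    \sum_(a : substitute B m) F (tag a) = \sum_x copies B m x * F x.
  rewrite -(sig_big_dep predT (fun _ => predT) (fun x _ => F x)).
  by apply: eq_bigr => x _; rewrite sum_nat_const card_ord.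
rewrite !card_sum big_sumType /=.
under eq_bigr do rewrite inE /=.
under [X in _ + X]eq_bigr do rewrite inE /=.
rewrite (sub_sum (fun x => (x \in T) : nat)).
rewrite -(pair_bigA _ (fun b (i : 'I_m.-1) => (tag (val b) \in T) : nat)) /=.
rewrite -(big_sub _ (fun a => \sum_(i < m.-1) (tag a \in T))).
rewrite [X in _ + X]big_mkcond /=.
under [X in _ + X]eq_bigr do rewrite inE sum_nat_const card_ord.
rewrite (sub_sum (fun x => if x \in A then m.-1 * (x \in T) else 0)).
rewrite -big_split big_distrr /=; apply: eq_bigr => x _.
rewrite /copies (bipartition_notin _ AB); case: (x \in A) => /=.
  by rewrite !mul1n -mulSn prednK.
by rewrite muln0 addn0.
Qed.

Lemma card_star : #|star| = m * #|G|.
Proof. by rewrite -!cardsT -card_star_proj preimsetT. Qed.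

(** The message part of the expansion: the pendants of [u] lie in the other
    part, with the copies of [B]. *)
Definition star_centers : {set star} := star_embed @: A.

Lemma star_centers_inl (a : substitute B m) :
  (inl a \in star_centers) = (tag a \in A).
Proof.
apply/imsetP/idP => [[x xA [->]]//|aA].
by exists (tag a); rewrite // (star_embed_proj aA).
Qed.

Lemma star_centers_inr q : (inr q \in star_centers) = false.
Proof. by apply/imsetP => -[]. Qed.

Lemma star_bipartition : bipartition star_centers (~: star_centers).
Proof.
have [_ _ iA iB] := AB; split.
- exact: setUCr.
- by rewrite disjoints_subset setCK.
- by move=> _ _ /imsetP[x xA ->] /imsetP[y yA ->]; exact: iA.
have pendA
    (q : {b : substitute B m | b \in [set a | tag a \in A]} * 'I_m.-1) :
    tag (val q.1) \in A.
  by have := valP q.1; rewrite inE.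
move=> [a|q] [b|q']; rewrite !inE ?star_centers_inl //= => aA bA.
- by apply: iB; rewrite (bipartition_notin _ AB).
- by apply: contra aA => /eqP ->; exact: pendA.
- by apply: contra bA => /eqP ->; exact: pendA.
Qed.

Lemma adj_star_embed (z : star) x : x \in A ->
  adj z (star_embed x) =
  match z with inl a => adj (tag a) x | inr q => x == tag (val q.1) end.
Proof.
move=> xA; case: z => [a|q] //=; apply/eqP/eqP => [<-//|E].
have := valP q.1; rewrite inE => /star_embed_proj; rewrite -E => -[->] //.
Qed.

(** Coordinates of the expansion repeat those of [G]: a copy of [w] has the
    parity of [w], and a pendant at [u] has [u] as its only neighbour, so its
    parity is the membership of [u] in [X]. *)
Lemma codeword_star (X : {set G}) : X \subset A ->
  codeword (star_embed @: X) = star_proj @^-1: codeword X.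
Proof.
move=> XA; have [_ _ iA _] := AB; apply/setP => z; rewrite !inE.
have -> : [set x in star_embed @: X | adj z x] =
    star_embed @: [set x in X | adj z (star_embed x)].
  apply/setP => y; rewrite inE; apply/andP/imsetP => [[/imsetP[x xX ->] zx]|].
    by exists x; rewrite // inE xX.
  by case=> x; rewrite inE => /andP[xX zx] ->; rewrite imset_f.
rewrite card_imset; last exact: star_embed_inj.
case: z => [a|q].
  suff -> : (inl a \in star_embed @: X) = (tag a \in X) by [].
  apply/imsetP/idP => [[x xX [->]]//|aX].
  by exists (tag a); rewrite // (star_embed_proj (subsetP XA _ aX)).
have -> : (inr q \in star_embed @: X) = false by apply/imsetP => -[].
have qA : tag (val q.1) \in A by have := valP q.1; rewrite inE.
have := codeword_independent iA XA qA; rewrite inE => ->.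
rewrite addFb /star_proj; set p := tag _ in qA *.
rewrite (eq_card (B := [pred x | (x == p) && (p \in X)])) => [|x].
  case pX: (p \in X); last by rewrite eq_card0 // => x; rewrite !inE ?andbF.
  by rewrite (eq_card (B := pred1 p)) ?card1 // => x; rewrite !inE ?andbT.
rewrite [LHS]inE [RHS]inE; case xX: (x \in X).
  rewrite andTb adj_star_embed ?(subsetP XA) // -/p.
  by case: eqP => // <-.
by case: eqP => //= <-.
Qed.

Lemma min_codeword_star d :
  min_codeword A d -> min_codeword star_centers (m * d).
Proof.
have card_cw (X : {set G}) : X \subset A ->
    #|codeword (star_embed @: X)| = m * #|codeword X|.
  by move=> XA; rewrite codeword_star // card_star_proj.
move=> [[X [XA X0 <-]] dmin]; split.
  exists (star_embed @: X); rewrite card_cw // imset_eq0; split=> //.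
  exact: imsetS.
move=> Y YA.
have [Z ZA ->] : exists2 Z : {set G}, Z \subset A & Y = star_embed @: Z.
  exists (star_embed @^-1: Y).
    apply/subsetP => x; rewrite inE => /(subsetP YA).
    by rewrite mem_imset //; exact: star_embed_inj.
  apply/setP => z; apply/idP/imsetP => [zY|[x]]; last by rewrite inE => ? ->.
  have /imsetP[x _ zx] := subsetP YA z zY.
  by exists x; rewrite // inE -zx.
by rewrite imset_eq0 => Z0; rewrite card_cw // leq_mul2l dmin ?orbT.
Qed.

(** A pendant and its centre form a codeword of weight 2.  A codeword contains
    its message, so it has weight at least 2 unless the message is a single
    vertex, and then it also contains a neighbour of that vertex. *)
Lemma min_codeword_star_dual : 1 < m -> A != set0 ->
  (forall y, y \in B -> exists x, adj y x) ->
  min_codeword (~: star_centers) 2.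
Proof.
move=> m_gt1 /set0Pn[x xA] nbB; have [_ _ _ iL] := star_bipartition.
have m1_gt0 : 0 < m.-1 by rewrite -ltnS prednK.
have pend u : u \in A -> exists2 q : star, q \notin star_centers &
    forall z : star, adj z q = (z == star_embed u).
  move=> uA; pose a : substitute B m :=
    Tagged (fun x => 'I_(copies B m x)) (Ordinal (copies_gt0 u)).
  have aA : a \in [set a : substitute B m | tag a \in A] by rewrite inE.
  exists (inr (exist _ a aA, Ordinal m1_gt0)); last by case.
  by rewrite star_centers_inr.
have center (z : star) : z \notin star_centers ->
    exists2 c, c \in star_centers & adj c z.
  case: z => [a|q]; rewrite ?star_centers_inl => zA.
    have [|y ay] := nbB (tag a); first by rewrite (bipartition_notin _ AB).
    have yA : y \in A.
      have [_ _ _ iB] := AB; apply: contraLR ay => yA.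
      by apply: iB; rewrite (bipartition_notin _ AB).
    by exists (star_embed y); rewrite ?imset_f // adj_sym adj_star_embed.
  have qA : tag (val q.1) \in A by have := valP q.1; rewrite inE.
  exists (star_embed (tag (val q.1))); first exact: imset_f.
  by rewrite adj_sym adj_star_embed.
split.
  have [q qL q_adj] := pend x xA; exists [set q]; rewrite sub1set inE qL.
  rewrite -card_gt0 cards1 codeword1; split=> //.
  rewrite (eq_card (B := [set q; star_embed x])) => [|z].
    by rewrite cards2; case: eqP => // E; rewrite E imset_f in qL.
  by rewrite !inE q_adj.
move=> Y YL /set0Pn[y yY]; have yL : y \notin star_centers.
  by have := subsetP YL y yY; rewrite inE.
have [/eqP/cards1P[z Yz]|Y1] := eqVneq #|Y| 1.
  move: yY; rewrite Yz inE => /eqP <-; rewrite codeword1.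
  have [c cA cy] := center y yL.
  apply: leq_trans (subset_leq_card (_ : [set y; c] \subset _)).
    by rewrite cards2; case: eqP => // E; rewrite E cA in yL.
  by apply/subsetP => t; rewrite !inE => /orP[->//|/eqP->]; rewrite cy orbT.
apply: (@leq_trans #|Y|).
  by rewrite ltn_neqAle eq_sym Y1 card_gt0; apply/set0Pn; exists y.
apply/subset_leq_card/subsetP => z zY.
by rewrite (codeword_independent iL YL) // (subsetP YL).
Qed.

End StarExpansion.

(** * Parameters of the codes of a star expansion *)

Lemma star_expansion_codes (G : graph) (A B : {set G}) m d (C : code #|G|) :
  bipartition A B -> (forall y, y \in B -> exists x, adj y x) -> 1 < m ->
  std_generated C (biadjacency A B) -> min_distance C d ->
  exists D : code (m * #|G|),
    [/\ corresponds (star_expansion B A m) D, is_code #|A| (m * d) D,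
        corresponds (star_expansion B A m) (dual D) &
        is_code (m * #|G| - #|A|) 2 (dual D)].
Proof.
move=> AB nbB m_gt1 CP; have m_gt0 := ltnW m_gt1.
rewrite (std_generated_min_distance _ AB CP) => minA.
have SAB := star_bipartition AB m_gt0.
have card_centers : #|star_centers A B m_gt0| = #|A|.
  by rewrite card_imset //; exact: star_embed_inj.
have cardS := etrans (card_bipartition SAB) (card_star AB m_gt0).
set L := star_centers A B m_gt0 in SAB card_centers cardS.
have [D DQ] := std_generated_exists (biadjacency L (~: L)) cardS.
have dDQ := std_generated_dual DQ; rewrite biadjacency_tr in dDQ.
have SBA := bipartition_sym SAB.
exists D; split.
- exact: std_generated_corresponds DQ.
- split; first by rewrite (std_generated_dim DQ).
  by apply/(std_generated_min_distance _ SAB DQ)/min_codeword_star.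
- exact: std_generated_corresponds dDQ.
split; first by rewrite (std_generated_dim dDQ) -cardS card_centers addKn.
apply/(std_generated_min_distance _ SBA dDQ)/min_codeword_star_dual => //.
(* A nonzero message exists, so [A] is nonempty and there is a pendant. *)
case: minA => -[X [XA X0 _]] _.
by apply: contraNneq X0 => A0; rewrite A0 subset0 in XA.
Qed.

Lemma connected_neighbor (G : graph) (x : G) :
  connected G -> 1 < #|G| -> exists y, adj x y.
Proof.
move=> Gconn /card_gt1P[a [b [_ _ ab]]].
have [y xy] : exists y, x != y.
  by have [xa|xa] := eqVneq x a; [exists b; rewrite xa | exists a].
have /connectP[[|z p] /= ] := Gconn x y.
  by move=> _ E; rewrite E eqxx in xy.
by case/andP=> xz _ _; exists z.
Qed.

Theorem theorem12 (G : graph) (U W : {set G}) (k r d d' m : nat) (C : code k)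
    (card_G : #|G| = k) (k_ge2 : 2 <= k)
    (G_connected : connected G)
    (G_elc : elc_preserved G)
    (G_bip : bipartition U W)
    (card_U : #|U| = r) (card_W : #|W| = k - r)
    (r_le : r <= k - r)
    (m_gt1 : 1 < m)
    (G_corr : corresponds G C)
    (C_code : is_code r d C)
    (C_rows : std_generated C (biadjacency U W))
    (G_corr_dual : corresponds G (dual C))
    (C_dual_code : is_code (k - r) d' (dual C)) :
  (exists D : code (m * k),
     [/\ corresponds (S_plus U W m) D,
         is_code r (m * d) D,
         corresponds (S_plus U W m) (dual D) &
         is_code (m * k - r) 2 (dual D)]) /\
  (exists D : code (m * k),
     [/\ corresponds (S_minus U W m) D,
         is_code (k - r) (m * d') D,
         corresponds (S_minus U W m) (dual D) &
         is_code (m * k - k + r) 2 (dual D)]).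
Proof.
subst k r; have nb x := connected_neighbor x G_connected k_ge2.
split; first by have [_ ?] := C_code; apply: star_expansion_codes C_rows _.
have dim_eq : m * #|G| - #|G| + #|U| = m * #|G| - #|W|.
  have GmG : #|G| <= m * #|G| by rewrite leq_pmull // ltnW.
  rewrite addnBAC // -[X in _ - X = _](card_bipartition G_bip).
  by rewrite (addnC _ #|U|) subnDl.
have C_dual_rows := std_generated_dual C_rows.
rewrite biadjacency_tr in C_dual_rows.
rewrite dim_eq -card_W; have [_ ?] := C_dual_code.
by apply: star_expansion_codes (bipartition_sym G_bip) _ _ C_dual_rows _.
Qed.
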